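(* Let $f\in\mathbb{C}[X_1,\ldots,X_n]^n$ be a square polynomial system, let $\xi\in\mathbb{C}^n$ be an isolated singular zero of $f$, and let $\kappa=\dim\ker Df(\xi)$. Consider a singular value decomposition $Df(\xi)=U\cdot\Sigma\cdot V^*$ with $U=[U_1,U_2]$, $V=[V_1,V_2]$, where $U_2,V_2\in\mathbb{C}^{n\times\kappa}$, $\operatorname{im}V_1=(\ker Df(\xi))^{\perp}$ and $\operatorname{im}V_2=\ker Df(\xi)$. Then for $v\in\ker Df(\xi)$, the $\kappa\times\kappa$ matrix $$\mathcal{B}(\xi)=U_2^*\cdot D^2f(\xi)\cdot v\cdot V_2$$ is invertible if and only if the linear operator $$\mathcal{A}(\xi)=Df(\xi)+D^2f(\xi)\bigl(v,\Pi_{\ker Df(\xi)}\,\cdot\,\bigr):\mathbb{C}^n\to\mathbb{C}^n$$ (with the same $v$) is invertible.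
   Context: $Df(\xi)$ is the Jacobian matrix of $f$ at $\xi$, and $D^2f(\xi)$ is the tensor of second-order partial derivatives, viewed as a symmetric bilinear map $\mathbb{C}^n\times\mathbb{C}^n\to\mathbb{C}^n$ with $i$-th component $D^2f(\xi)(u,w)_i=\sum_{j,k}\frac{\partial^2 f_i}{\partial X_j\partial X_k}(\xi)u_jw_k$. For a vector $v$, $D^2f(\xi)\cdot v$ is the $n\times n$ matrix of $w\mapsto D^2f(\xi)(v,w)$. $\Pi_{\ker Df(\xi)}$ is the Hermitian (orthogonal) projection onto $\ker Df(\xi)$. $U,V$ are unitary, $\Sigma$ is diagonal with the singular values in decreasing order, and $^*$ is conjugate transpose. $\xi$ is an isolated singular zero of $f$ if $f(\xi)=0$, $\xi$ is the only zero of $f$ in some ball around $\xi$ of positive radius, and $\dim\ker Df(\xi)>0$. *)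

(* Defs.v *)
From HB Require Import structures.
From mathcomp Require Import all_boot all_order all_algebra.
From mathcomp Require Import reals complex mpoly.

Set Implicit Arguments.
Unset Strict Implicit.
Unset Printing Implicit Defensive.

Import Order.TTheory GRing.Theory Num.Theory.

Local Open Scope ring_scope.
Local Open Scope complex_scope.
Local Open Scope sesquilinear_scope.

Definition evalsys (R : realType) (n : nat) (f : 'I_n -> {mpoly R[i][n]})
    (x : 'cV[R[i]]_n) : 'cV[R[i]]_n :=
  \col_i (f i).@[fun j => x j 0].

Definition jacobian (R : realType) (n : nat) (f : 'I_n -> {mpoly R[i][n]})
    (x : 'cV[R[i]]_n) : 'M[R[i]]_n :=
  \matrix_(i, j) ((f i)^`M(j)).@[fun l => x l 0].

Definition D2 (R : realType) (n : nat) (f : 'I_n -> {mpoly R[i][n]})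
    (x u w : 'cV[R[i]]_n) : 'cV[R[i]]_n :=
  \col_i \sum_j \sum_k
    (((f i)^`M(k))^`M(j)).@[fun l => x l 0] * u j 0 * w k 0.

(* Matrix, in the canonical basis, of the linear map [w |-> D2 f x v w]. *)
Definition D2mx (R : realType) (n : nat) (f : 'I_n -> {mpoly R[i][n]})
    (x v : 'cV[R[i]]_n) : 'M[R[i]]_n :=
  \matrix_(i, k) D2 f x v (delta_mx k 0) i 0.

(* [kermx] is the kernel of the action on row vectors; matrices act here on
   columns, so the rows of [rker A] span the transposes of the vectors [w] such
   that [A *m w = 0]; its rank is the dimension of that kernel. *)
Definition rker (C : fieldType) (n : nat) (A : 'M[C]_n) : 'M[C]_n := kermx A^T.

(* [proj_ortho] acts on row vectors, hence the outer transpose.  Plain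
   transposition preserves Hermitian orthogonality: (z^T)(w^T)^* is the
   conjugate of z^* w. *)
Definition ker_proj (C : numClosedFieldType) (n : nat) (A : 'M[C]_n) : 'M[C]_n :=
  (proj_ortho (rker A))^T.

Definition opA (R : realType) (n : nat) (f : 'I_n -> {mpoly R[i][n]})
    (x v w : 'cV[R[i]]_n) : 'cV[R[i]]_n :=
  jacobian f x *m w + D2 f x v (ker_proj (jacobian f x) *m w).

Definition edist (R : realType) (n : nat) (x y : 'cV[R[i]]_n) : R[i] :=
  sqrtC (\sum_i `|x i 0 - y i 0| ^+ 2).

Definition isolated_singular_zero (R : realType) (n : nat)
    (f : 'I_n -> {mpoly R[i][n]}) (x : 'cV[R[i]]_n) : Prop :=
  [/\ evalsys f x = 0,
      exists2 r : R, 0 < r &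
        forall y, edist y x < r%:C -> evalsys f y = 0 -> y = x
    & (0 < \rank (rker (jacobian f x)))%N].

(* The order on [C] entails reality: [0 <= s 0 i] says that the singular value
   [s 0 i] is a nonnegative real number. *)
Definition is_svd (C : numClosedFieldType) (n : nat)
    (A U : 'M[C]_n) (s : 'rV[C]_n) (V : 'M[C]_n) : Prop :=
  [/\ U \is unitarymx, V \is unitarymx,
      forall i, 0 <= s 0 i,
      forall i j : 'I_n, (i <= j)%N -> s 0 j <= s 0 i
    & A = U *m diag_mx s *m V^t*].

Definition in_im (C : fieldType) (n p : nat) (W : 'M[C]_(n, p))
    (w : 'cV[C]_n) : Prop :=
  exists u : 'cV[C]_p, w = W *m u.

Definition in_ker (C : fieldType) (n : nat) (A : 'M[C]_n) (w : 'cV[C]_n) : Prop :=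
  A *m w = 0.

Definition in_ker_ortho (C : numClosedFieldType) (n : nat) (A : 'M[C]_n)
    (w : 'cV[C]_n) : Prop :=
  forall z : 'cV[C]_n, in_ker A z -> z^t* *m w = 0.

Lemma rkerP (C : fieldType) (n : nat) (A : 'M[C]_n) (w : 'cV[C]_n) :
  (w^T <= rker A)%MS <-> in_ker A w.
Proof.
rewrite /rker /in_ker; split=> [/sub_kermxP|] h.
  by apply: trmx_inj; rewrite trmx_mul h trmx0.
by apply/sub_kermxP; rewrite -trmx_mul h trmx0.
Qed.

Lemma D2mxE (R : realType) (n : nat) (f : 'I_n -> {mpoly R[i][n]})
    (x v w : 'cV[R[i]]_n) : D2mx f x v *m w = D2 f x v w.
Proof.
apply/colP => i; rewrite !mxE exchange_big /=; apply: eq_bigr => k _.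
rewrite !mxE mulr_suml; apply: eq_bigr => j _.
rewrite (bigD1 k) //= mxE !eqxx mulr1 big1 ?addr0 // => l lk.
by rewrite mxE (negbTE lk) mulr0.
Qed.

Lemma opAE (R : realType) (n : nat) (f : 'I_n -> {mpoly R[i][n]})
    (x v w : 'cV[R[i]]_n) :
  opA f x v w = (jacobian f x + D2mx f x v *m ker_proj (jacobian f x)) *m w.
Proof. by rewrite /opA mulmxDl -mulmxA D2mxE. Qed.

Lemma ker_proj_in (C : numClosedFieldType) (n : nat) (A : 'M[C]_n)
    (w : 'cV[C]_n) : in_ker A (ker_proj A *m w).
Proof.
by apply/rkerP; rewrite trmx_mul trmxK proj_ortho_sub.
Qed.

Lemma ker_proj_ortho (C : numClosedFieldType) (n : nat) (A : 'M[C]_n)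
    (w : 'cV[C]_n) : in_ker_ortho A (w - ker_proj A *m w).
Proof.
move=> z /rkerP zA.
have := proj_ortho_compl_sub (rker A) w^T.
rewrite orthomx1E; set d := w - _.
have -> : w^T - w^T *m proj_ortho (rker A) = d^T.
  by rewrite /d /ker_proj linearB /= trmx_mul trmxK.
move=> /eqP dA; apply: trmx_inj; rewrite trmx_mul trmx0.
have /submxP[D zD] := zA.
by rewrite zD map_mxM trmx_mul mulmxA map_trmx dA mul0mx.
Qed.

(* Main.v *)
Require Import Defs.
From HB Require Import structures.
From mathcomp Require Import all_boot all_order all_algebra.
From mathcomp Require Import reals complex mpoly.

Import Order.TTheory GRing.Theory Num.Theory.

Local Open Scope ring_scope.
Local Open Scope complex_scope.
Local Open Scope sesquilinear_scope.

(** Let [J] be the Jacobian matrix, [M] the matrix of [D2 f xi v] and [Pi] the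
    orthogonal projection onto [ker J].  In the singular bases [U] and [V],
    the matrix [J + M *m Pi] of the operator becomes block upper triangular:
[[
      U^t* (J + M Pi) V  =  [ S   U1^t* M V2 ]
                            [ 0   U2^t* M V2 ]
]]
    Indeed the columns of [V1] are killed by [Pi] and those of [V2] by [J],
    while [U^t* J V] is the diagonal matrix of singular values, whose lower
    left block [U2^t* J V1] vanishes.  The upper left block [S = U1^t* J V1]
    is square of size [m = \rank J] and carries the whole rank of [J], so it is
    invertible.  Hence the full matrix is invertible exactly when its lower
    right block is, and that block is the matrix in question
    ([unitmx_svd_corner]).  The projection enters only through its values on
    [ker J] and on the orthogonal complement ([ker_proj_id],
    [ker_proj_eq0]). *)

Lemma in_ker_ortho_eq0 (C : numClosedFieldType) (n : nat) (A : 'M[C]_n)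
    (w : 'cV[C]_n) : in_ker A w -> in_ker_ortho A w -> w = 0.
Proof.
move=> Aw /(_ w Aw) /matrixP/(_ 0 0); rewrite !mxE => w0.
apply/colP => i; rewrite mxE; apply/eqP.
have /psumr_eq0P h : forall i, true -> 0 <= (w^t*) 0 i * w i 0.
  by move=> k _; rewrite !mxE mulrC mul_conjC_ge0.
by have := h w0 i isT; rewrite !mxE mulrC => /eqP; rewrite mul_conjC_eq0.
Qed.

(** The difference [w - ker_proj A *m w] is always orthogonal to [ker A]; for
    [w] in [ker A] this difference is itself in [ker A], so it vanishes. *)
Lemma ker_proj_id (C : numClosedFieldType) (n : nat) (A : 'M[C]_n)
    (w : 'cV[C]_n) : in_ker A w -> ker_proj A *m w = w.
Proof.
move=> Aw; apply/esym/eqP; rewrite -subr_eq0; apply/eqP.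
apply: (in_ker_ortho_eq0 _ _ A); last exact: ker_proj_ortho.
by rewrite /in_ker mulmxBr Aw ker_proj_in subr0.
Qed.

(** Dually, for [w] orthogonal to [ker A], the projection of [w] is the
    difference of two vectors orthogonal to [ker A], yet lies in [ker A]. *)
Lemma ker_proj_eq0 (C : numClosedFieldType) (n : nat) (A : 'M[C]_n)
    (w : 'cV[C]_n) : in_ker_ortho A w -> ker_proj A *m w = 0.
Proof.
move=> Aw; apply: (in_ker_ortho_eq0 _ _ A) => [|z Az]; first exact: ker_proj_in.
have := ker_proj_ortho w Az.
by rewrite mulmxBr Aw // sub0r => /eqP; rewrite oppr_eq0 => /eqP.
Qed.

Lemma unitmx_bijective (F : fieldType) (n : nat) (N : 'M[F]_n) :
  N \in unitmx <-> bijective (fun w : 'cV[F]_n => N *m w).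
Proof.
split=> [uN | [g _ gK]].
  by exists (fun w => invmx N *m w) => w; rewrite ?mulKmx ?mulKVmx.
(* The preimages of the canonical basis are the columns of a right inverse. *)
pose G := \matrix_(i, j) g (delta_mx j 0) i 0.
suff /mulmx1_unit[] : N *m G = 1%:M by [].
apply/matrixP => i j; have /colP/(_ i) := gK (delta_mx j 0).
rewrite !mxE eqxx andbT => <-.
by apply: eq_bigr => k _; rewrite mxE.
Qed.

(** Conjugating [J + M *m P] by the two unitary matrices makes it block upper
    triangular, with [U2^t* *m M *m V2] in the lower right corner.  The upper
    left block [U1^t* *m J *m V1] is invertible by counting ranks: [U^t* J V]
    has the rank [m] of [J], and its three other blocks are zero. *)
Lemma unitmx_svd_corner (C : numClosedFieldType) (m k : nat)
    (J M P : 'M[C]_(m + k)) (s : 'rV[C]_(m + k))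
    (U1 V1 : 'M[C]_(m + k, m)) (U2 V2 : 'M[C]_(m + k, k)) :
  row_mx U1 U2 \is unitarymx -> row_mx V1 V2 \is unitarymx ->
  J = row_mx U1 U2 *m diag_mx s *m (row_mx V1 V2)^t* ->
  \rank J = m -> J *m V2 = 0 -> P *m V1 = 0 -> P *m V2 = V2 ->
  (U2^t* *m M *m V2 \in unitmx) = (J + M *m P \in unitmx).
Proof.
set U := row_mx U1 U2; set V := row_mx V1 V2 => uU uV Jsvd rJ JV2 PV1 PV2.
have unitU : U^t* \in unitmx by rewrite unitarymx_unit ?trmxC_unitary.
have unitV : V \in unitmx by apply: unitarymx_unit.
have UC : U^t* = col_mx (U1^t*) (U2^t*) by rewrite tr_row_mx map_col_mx.
have conjE (N : 'M_(m + k)) : U^t* *m N *m V =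
    block_mx (U1^t* *m N *m V1) (U1^t* *m N *m V2)
             (U2^t* *m N *m V1) (U2^t* *m N *m V2).
  by rewrite UC mul_col_mx mul_col_row.
have diagJ : U^t* *m J *m V = diag_mx s.
  rewrite Jsvd !mulmxA.
  have /mulmx1C -> : U *m U^t* = 1%:M by apply/unitarymxP.
  have /mulmx1C VV : V *m V^t* = 1%:M by apply/unitarymxP.
  by rewrite mul1mx -mulmxA VV mulmx1.
have U2JV1 : U2^t* *m J *m V1 = 0.
  apply/matrixP => i j; rewrite [RHS]mxE.
  have /matrixP/(_ (rshift m i) (lshift k j)) := diagJ.
  by rewrite conjE block_mxEdl => ->; rewrite mxE eq_rlshift.
have unitS : U1^t* *m J *m V1 \in unitmx.
  have : \rank (U^t* *m J *m V) = m.
    by rewrite mxrankMfree ?row_free_unit // eqmxMfull ?row_full_unit.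
  rewrite conjE -!(mulmxA _ J V2) JV2 !mulmx0 U2JV1 rank_diag_block_mx.
  by rewrite mxrank0 addn0 => rS; rewrite -row_free_unit /row_free rS.
have -> : (J + M *m P \in unitmx) = (U^t* *m (J + M *m P) *m V \in unitmx).
  by rewrite !unitmx_mul unitU unitV andbT.
have PE : (J + M *m P) *m V = row_mx (J *m V1) (M *m V2).
  rewrite mul_mx_row !mulmxDl -!(mulmxA M) PV1 PV2 JV2.
  by rewrite mulmx0 addr0 add0r.
rewrite -[U^t* *m _ *m V]mulmxA PE UC mul_col_row !mulmxA U2JV1.
by rewrite unitmxE [in RHS]unitmxE det_ublock unitrM -!unitmxE unitS.
Qed.

Theorem theorem5 (R : realType) (n : nat) (f : 'I_n -> {mpoly R[i][n]})
    (xi : 'cV[R[i]]_n) (hxi : isolated_singular_zero f xi)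
    (kappa : nat) (hkappa : kappa = \rank (rker (jacobian f xi)))
    (m : nat) (hm : (m + kappa)%N = n)
    (U V : 'M[R[i]]_n) (s : 'rV[R[i]]_n)
    (hsvd : is_svd (jacobian f xi) U s V)
    (U1 V1 : 'M[R[i]]_(n, m)) (U2 V2 : 'M[R[i]]_(n, kappa))
    (hU : U = castmx (erefl n, hm) (row_mx U1 U2))
    (hV : V = castmx (erefl n, hm) (row_mx V1 V2))
    (hV1 : forall w, in_im V1 w <-> in_ker_ortho (jacobian f xi) w)
    (hV2 : forall w, in_im V2 w <-> in_ker (jacobian f xi) w)
    (v : 'cV[R[i]]_n) (hv : in_ker (jacobian f xi) v) :
  U2^t* *m D2mx f xi v *m V2 \in unitmx <-> bijective (opA f xi v).
Proof.
have [uU uV _ _ Jsvd] := hsvd.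
have col_in p (W : 'M[R[i]]_(n, p)) j : in_im W (col j W).
  by exists (delta_mx j 0); rewrite colE.
have colP_mx p (W W' : 'M[R[i]]_(n, p)) :
    (forall j, col j W = col j W') -> W = W'.
  by move=> e; apply/matrixP => i j; have /colP/(_ i) := e j; rewrite !mxE.
have JV2 : jacobian f xi *m V2 = 0.
  by apply: colP_mx => j; rewrite colE -mulmxA -colE col0; apply/hV2.
have PV1 : ker_proj (jacobian f xi) *m V1 = 0.
  by apply: colP_mx => j; rewrite colE -mulmxA -colE col0; apply/ker_proj_eq0/hV1.
have PV2 : ker_proj (jacobian f xi) *m V2 = V2.
  by apply: colP_mx => j; rewrite colE -mulmxA -colE; apply/ker_proj_id/hV2.
have rJ : \rank (jacobian f xi) = m.
  have rle := rank_leq_row (jacobian f xi).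
  apply/eqP; rewrite -(eqn_add2r kappa) hm hkappa /rker mxrank_ker mxrank_tr.
  by rewrite subnKC.
have -> : U2^t* *m D2mx f xi v *m V2 \in unitmx =
  (jacobian f xi + D2mx f xi v *m ker_proj (jacobian f xi) \in unitmx).
  move: (jacobian f xi) (D2mx f xi v) Jsvd JV2 PV1 PV2 rJ => J M.
  move: (ker_proj J) uU uV; rewrite {}hU {}hV.
  clear -hm; case: n / hm s U1 U2 V1 V2 J M => s U1 U2 V1 V2 J M P.
  rewrite !castmx_id => uU uV Jsvd JV2 PV1 PV2 rJ.
  exact: unitmx_svd_corner uU uV Jsvd rJ JV2 PV1 PV2.
by rewrite unitmx_bijective; split=> /eq_bij; apply=> w; rewrite opAE.
Qed.
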